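(* Let $\Gamma$ be a finite topological network with edges $e_j$ ($j\in J$), boundary vertices $v_i$ ($i\in I_B$) and transition vertices $v_i$ ($i\in I_T$). Let $\beta_{ij}>0$ for every $i\in I_T$, $j\in Inc_i$, and $g_i\in\mathbb{R}$ for $i\in I_B$. Assume that the Hamiltonian $H=(H^j)_{j\in J}$ satisfies: (1) $H^j\in C^0([0,l_j]\times\mathbb{R}\times\mathbb{R})$ for $j\in J$; (2) $H^j(x,\cdot,p)$ is nondecreasing for all $(x,p)\in[0,l_j]\times\mathbb{R}$, $j\in J$; (3) $H^j(v_i,r,\cdot)$ is nondecreasing in $(0,+\infty)$ for any $i\in I_T$, $j\in Inc_i$, $r\in\mathbb{R}$; (4) for every $R>0$ and $j\in J$, $H^j(x,r,p)\to+\infty$ as $|p|\to\infty$ uniformly in $(x,r)\in[0,l_j]\times[-R,R]$; (5) $H^j(\pi_j^{-1}(v_i),r,p)=H^k(\pi_k^{-1}(v_i),r,p)$ for any $r,p\in\mathbb{R}$, $i\in I_T$, $j,k\in Inc_i$; (6) $H^j(\pi_j^{-1}(v_i),r,p)=H^j(\pi_j^{-1}(v_i),r,-p)$ for any $r,p\in\mathbb{R}$, $i\in I_T$, $j\in Inc_i$. Let $\varepsilon_n>0$ with $\varepsilon_n\to0$, and let $u_n\in C^2_{*,\beta}(\Gamma)$ be a sequence of solutions of $$-\varepsilon_n\,\partial_j^2 u_n+H^j(x,u_n,\partial_j u_n)=0\ \ (x\in e_j,\ j\in J),\qquad S^i_\beta u_n=0\ \ (i\in I_T),\qquad u_n(v_i)=g_i\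 \ (i\in I_B),$$ such that $u_n$ and $\partial u_n$ are uniformly bounded on $\Gamma$ (uniformly in $n$). If $u_n$ converges uniformly to a function $u\in C(\Gamma)$, then $u$ is a viscosity solution of $$H(x,u,\partial u)=0,\qquad x\in\Gamma.$$
   Context: Topological network: let $V=\{v_i: i\in I\}$ be a finite set of points of $\mathbb{R}^n$ and $\pi_j:[0,l_j]\to\mathbb{R}^n$, $l_j>0$, $j\in J$ ($J$ finite), smooth non-self-intersecting curves; put $e_j:=\pi_j((0,l_j))$, $\bar e_j:=\pi_j([0,l_j])$. Assume: (i) $\pi_j(0),\pi_j(l_j)\in V$ and $\#(\bar e_j\cap V)=2$ for all $j$; (ii) $\bar e_j\cap\bar e_k\subset V$ and $\#(\bar e_j\cap\bar e_k)\le 1$ for $j\ne k$; (iii) any two vertices are joined by a path of edges. Then $\Gamma:=\bigcup_{j\in J}\bar e_j$. A point $x\in\bar e_j$ is identified with $\pi_j^{-1}(x)\in[0,l_j]$. $Inc_i:=\{j\in J: e_j\text{ is incident to }v_i\}$. The signed incidence matrix is $a_{ij}=1$ if $v_i\in\bar e_j$ and $\pi_j(0)=v_i$, $a_{ij}=-1$ if $v_i\in\bar e_j$ and $\pi_j(l_j)=v_i$, $a_{ij}=0$ otherwise. A nonempty set $I_B\subset I$ is fixed, containing every $i$ with $\#Inc_i=1$; moreover it is assumed that $\#Inc_i=1$ for every $i\in I_B$. $\partial\Gamma:=\{v_i:i\in I_B\}$ (boundary vertices), $I_T:=I\setminus I_B$ (transition vertices). Function spaces: for $u:\Gamma\to\mathbb{R}$,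 $u^j:=u\circ\pi_j:[0,l_j]\to\mathbb{R}$, and $\partial_j^\alpha u(x):=\frac{d^\alpha u^j}{dy^\alpha}(\pi_j^{-1}(x))$ for $x\in e_j$ or $x=v_i$ with $j\in Inc_i$ (one-sided at endpoints). $u\in C^k(\Gamma)$ means $u$ is continuous on $\Gamma$ and $u^j\in C^k([0,l_j])$ for all $j\in J$. For $i\in I_T$, $S^i_\beta u:=\sum_{j\in Inc_i}\beta_{ij}a_{ij}\partial_ju(v_i)$, and $C^k_{*,\beta}(\Gamma)$ ($k\ge1$) is the set of $u\in C^k(\Gamma)$ with $S^i_\beta u=0$ for all $i\in I_T$. $USC(\Gamma)$, $LSC(\Gamma)$: upper/lower semicontinuous functions on $\Gamma$ (topology induced by $\mathbb{R}^n$). A Hamiltonian $H$ is a collection $(H^j)_{j\in J}$ with $H^j:[0,l_j]\times\mathbb{R}\times\mathbb{R}\to\mathbb{R}$. Test functions: let $\phi\in C(\Gamma)$. For $x\in e_j$, $\phi$ is a test function at $x$ if $\phi^j$ is differentiable at $\pi_j^{-1}(x)$. For $x=v_i$, $i\in I_T$, and $j,k\in Inc_i$, $j\ne k$, $\phi$ is a $(j,k)$-test function at $x$ if $\phi^j$, $\phi^k$ are differentiable at $\pi_j^{-1}(x)$, $\pi_k^{-1}(x)$ respectively and $a_{ij}\partial_j\phi(x)+a_{ik}\partial_k\phi(x)=0$. Viscosity solutions of $H(x,u,\partial u)=0$: $u\in USC(\Gamma)$ is a subsolution if (i) for $x\in e_j$, $j\in J$, and any test function $\phi$ at $x$ such that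 $u-\phi$ has a local maximum at $x$, $H^j(x,u^j(x),\partial_j\phi(x))\le0$; (ii) for $x=v_i$, $i\in I_T$, any $j,k\in Inc_i$, $j\neq k$, and any $(j,k)$-test function $\phi$ at $x$ such that $u-\phi$ has a local maximum at $x$ relative to $\bar e_j\cup\bar e_k$, $H^j(x,u^j(x),\partial_j\phi(x))\le0$. $u\in LSC(\Gamma)$ is a supersolution if (i) for $x\in e_j$, $j\in J$, and any test function $\phi$ at $x$ such that $u-\phi$ has a local minimum at $x$, $H^j(x,u^j(x),\partial_j\phi(x))\ge0$; (ii) for $x=v_i$, $i\in I_T$, and for any $j\in Inc_i$ there exists $k\in Inc_i$, $k\ne j$, such that for any $(j,k)$-test function $\phi$ at $x$ for which $u-\phi$ has a local minimum at $x$ relative to $\bar e_j\cup\bar e_k$, $H^j(x,u^j(x),\partial_j\phi(x))\ge0$. A function $u\in C(\Gamma)$ is a (viscosity) solution if it is both a sub- and a supersolution. No condition is imposed at boundary vertices in this definition. *)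

(* Defs.v *)
From HB Require Import structures.
From mathcomp Require Import all_boot all_order all_algebra.
From mathcomp Require Import all_classical all_reals all_analysis.
Set Implicit Arguments.
Unset Strict Implicit.
Unset Printing Implicit Defensive.
Import Order.TTheory GRing.Theory Num.Theory.
Import numFieldNormedType.Exports.
Local Open Scope classical_set_scope.
Local Open Scope ring_scope.

Section Calculus.
Context {R : realType}.
Implicit Types (A : set R) (f : R -> R) (y : R) (k : nat).

(* The difference quotient is taken inside A: at an endpoint of an interval
   this is the one-sided derivative, at an interior point the usual one. *)
Definition diff_quot A f y : set_system R :=
  (fun z => (f z - f y) / (z - y)) @ within A (dnbhs y).

Definition derivable_in A f y : Prop := cvg (diff_quot A f y).

Definition deriv_in A f y : R := lim (diff_quot A f y).

Definition derivn_in A k f : R -> R := iter k (deriv_in A) f.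

Definition Ck_in A k f : Prop :=
  (forall m y, (m < k)%N -> A y -> derivable_in A (derivn_in A m f) y) /\
  (forall m, (m <= k)%N -> {within A, continuous (derivn_in A m f)}).

Definition smooth_in A f : Prop := forall k, Ck_in A k f.

End Calculus.

Section TopologicalSpace.
Context {R : realType} {T : topologicalType}.
Implicit Types (A : set T) (f : T -> R) (x : T).

Definition lsc_on A f : Prop :=
  lower_semicontinuous (fun x : subspace A => (f x)%:E).

Definition usc_on A f : Prop := lsc_on A (fun x => - f x).

Definition local_max_on A f x : Prop :=
  \forall y \near within A (nbhs x), f y <= f x.

Definition local_min_on A f x : Prop :=
  \forall y \near within A (nbhs x), f x <= f y.

End TopologicalSpace.

Record network_data (R : realType) (n : nat) := NetworkData {
  vidx : finType;
  eidx : finType;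
  vtx : vidx -> 'rV[R]_n;
  len : eidx -> R;
  crv : eidx -> R -> 'rV[R]_n;  (* only its values on [0, len j] matter *)
  bdry : {set vidx}
}.

Section Network.
Context {R : realType} {n : nat} (N : network_data R n).
Implicit Types (i : vidx N) (j k : eidx N) (x : 'rV[R]_n) (u phi : 'rV[R]_n -> R).

Definition param j : set R := `[0, len j]%classic.

Definition edge j : set 'rV[R]_n := crv j @` `]0, len j[%classic.

Definition cedge j : set 'rV[R]_n := crv j @` param j.

Definition vertices : set 'rV[R]_n := range (@vtx R n N).

Definition Gamma : set 'rV[R]_n := \bigcup_(j in [set: eidx N]) cedge j.

Definition inc i : {set eidx N} := [set j | `[< cedge j (vtx i) >] ]%SET.

Definition trans : {set vidx N} := (~: bdry N)%SET.

Definition adj : rel (vidx N) :=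
  fun i i' => [exists j, (j \in inc i) && (j \in inc i')].

Record is_network : Prop := IsNetwork {
  vtx_inj : injective (@vtx R n N);
  len_gt0 : forall j, 0 < len j;
  crv_smooth : forall j (c : 'I_n), smooth_in (param j) (fun y => crv j y ord0 c);
  crv_inj : forall j, {in param j &, injective (crv j)};
  crv_start : forall j, vertices (crv j 0);
  crv_end : forall j, vertices (crv j (len j));
  cedge_vertices : forall j, (cedge j `&` vertices #= `I_2)%card;
  cedge_cap : forall j k, j != k -> cedge j `&` cedge k `<=` vertices;
  cedge_cap_card : forall j k, j != k -> (cedge j `&` cedge k #<= `I_1)%card;
  net_connected : forall i i', connect adj i i';
  bdry_neq0 : bdry N != finset.set0;
  bdry_of_leaf : forall i, #|inc i| = 1%N -> i \in bdry N;
  bdry_leaf : forall i, i \in bdry N -> #|inc i| = 1%N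
}.

Definition a_ i j : R :=
  if vtx i == crv j 0 then 1
  else if vtx i == crv j (len j) then -1
  else 0.

(* The identification of x in the closed edge j with pi_j^-1(x). *)
Definition edge_coord j x : R := 'pinv_(fun=> 0) (param j) (crv j) x.

(* Functions on Gamma are represented by functions on the ambient space; every
   notion below depends on their restriction to Gamma only. *)
Definition on_edge u j : R -> R := u \o crv j.

Definition dern m j u x : R := derivn_in (param j) m (on_edge u j) (edge_coord j x).

Definition der j u x : R := dern 1 j u x.

Definition C0 u : Prop := {within Gamma, continuous u}.

Definition Ck m u : Prop := C0 u /\ forall j, Ck_in (param j) m (on_edge u j).

Definition kirchhoff (beta : vidx N -> eidx N -> R) i u : R :=
  \sum_(j in inc i) beta i j * a_ i j * der j u (vtx i).

Definition Ck_star (beta : vidx N -> eidx N -> R) m u : Prop :=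
  Ck m u /\ forall i, i \in trans -> kirchhoff beta i u = 0.

Definition hamiltonian := eidx N -> R -> R -> R -> R.
Implicit Type H : hamiltonian.

Definition test_edge j x phi : Prop :=
  C0 phi /\ derivable_in (param j) (on_edge phi j) (edge_coord j x).

Definition test_vertex i j k phi : Prop :=
  [/\ C0 phi,
      derivable_in (param j) (on_edge phi j) (edge_coord j (vtx i)),
      derivable_in (param k) (on_edge phi k) (edge_coord k (vtx i)) &
      a_ i j * der j phi (vtx i) + a_ i k * der k phi (vtx i) = 0].

Definition H_at H j u phi x : R :=
  H j (edge_coord j x) (on_edge u j (edge_coord j x)) (der j phi x).

Definition subsolution H u : Prop :=
  [/\ usc_on Gamma u,
      forall j x phi, edge j x -> test_edge j x phi ->
        local_max_on Gamma (u \- phi) x -> H_at H j u phi x <= 0 &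
      forall i j k phi, i \in trans -> j \in inc i -> k \in inc i -> j != k ->
        test_vertex i j k phi ->
        local_max_on (cedge j `|` cedge k) (u \- phi) (vtx i) ->
        H_at H j u phi (vtx i) <= 0].

Definition supersolution H u : Prop :=
  [/\ lsc_on Gamma u,
      forall j x phi, edge j x -> test_edge j x phi ->
        local_min_on Gamma (u \- phi) x -> 0 <= H_at H j u phi x &
      forall i j, i \in trans -> j \in inc i ->
        exists2 k, (k \in inc i) && (k != j) &
          forall phi, test_vertex i j k phi ->
            local_min_on (cedge j `|` cedge k) (u \- phi) (vtx i) ->
            0 <= H_at H j u phi (vtx i)].

Definition viscosity_solution H u : Prop :=
  [/\ C0 u, subsolution H u & supersolution H u].

Definition viscous_solution (eps : R) (beta : vidx N -> eidx N -> R)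
    (g : vidx N -> R) H u : Prop :=
  [/\ forall j x, edge j x ->
        - eps * dern 2 j u x + H j (edge_coord j x) (u x) (der j u x) = 0,
      forall i, i \in trans -> kirchhoff beta i u = 0 &
      forall i, i \in bdry N -> u (vtx i) = g i].

End Network.

(* Main.v *)
Require Import Defs.
From HB Require Import structures.
From mathcomp Require Import all_boot all_order all_algebra.
From mathcomp Require Import all_classical all_reals all_analysis.
From mathcomp Require Import ring lra.
Import Order.TTheory GRing.Theory Num.Theory.
Import numFieldNormedType.Exports.
Local Open Scope classical_set_scope.
Local Open Scope ring_scope.

(** Everything rests on one one-dimensional fact.  Let f_n converge uniformly
to f on [0, d], with eps_n f_n'' = F(s, f_n, f_n') and eps_n -> 0, and suppose
that f stays above the line of slope a through (0, f(0)), up to o(s).  If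
F(0, f(0), p) < 0 for all p in [a, b] with a <= b, then f_n'(0) > b for n
large ([right_derivative_gt_of_slope]).  Indeed, compare f_n with a C^2
function q whose slope starts slightly above b at 0 and drops within a very
short time to a value slightly below a.  At an interior minimum of f_n - q one
has f_n' = q', a slope at which F is below a negative constant, whereas
eps_n f_n'' >= eps_n q'' -> 0: impossible.  The right end is excluded
because f - q is larger there than at 0.  So the minimum is at 0, whence f_n'(0) >= q'(0) > b.

Read along an edge from a point y0 in a direction c = 1 or c = -1, and for
t u_n with t = 1 or t = -1, this yields every case of the theorem; t = 1 treats
supersolutions and t = -1 subsolutions.  Suppose that a test function phi
touches u but t H has the wrong sign, so that t H < 0 there.

- Inside an edge ([interior_touching]), take a = b = t c phi'.  The two
directions give t u_n' > t phi' and t u_n' < t phi' at the same point.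

- At a transition vertex the outgoing slopes of a (j,k)-test function sum to 0,
and H is an even function of the slope, nondecreasing in its absolute value,
and common to all the incident edges.  For a subsolution, one of the two
outgoing slopes is nonpositive; along that edge -u lies above a line of
nonnegative slope a, and H remains positive for all steeper slopes, so that b
can be taken above the uniform gradient bound: contradiction
([subsolution_descending_edge]).

- For a supersolution, if the edge j had no admissible partner k, each k would
come with a bad test function.  Take a = -|p| and b = |p| with p its slope: on
all the incident edges, j included, the outgoing derivatives of u_n become
positive ([outgoing_slope_gt0]), which contradicts the Kirchhoff condition with
positive weights. *)

Set Implicit Arguments.
Unset Strict Implicit.
Unset Printing Implicit Defensive.

(** * Second-order condition at a minimum *)

Lemma second_derivative_at_min (R : realType) (g g1 : R -> R) (x y c l : R) :
  c \in `]x, y[ -> (forall t, t \in `]x, y[ -> is_derive t 1 g (g1 t)) ->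
  is_derive c 1 g1 l -> (forall t, t \in `]x, y[ -> g c <= g t) ->
  g1 c = 0 /\ 0 <= l.
Proof.
move=> cxy dg dg1 gmin.
have lexy : x <= y by move: cxy; rewrite in_itv/= => /andP[/ltW + /ltW]; exact: le_trans.
have g1c0 : g1 c = 0.
  have dg0 : is_derive c 1 g 0.
    by apply: (derive1_at_min lexy _ cxy gmin) => t /dg [].
  have dgc := dg _ cxy.
  by rewrite -(@derive_val _ _ _ _ _ _ _ dgc) (@derive_val _ _ _ _ _ _ _ dg0).
split => //; rewrite leNgt; apply/negP => l0.
case: dg1 => dq lE; move: dq; rewrite /derivable => dq.
have {dq lE} : h^-1 *: (g1 (h *: 1 + c) - g1 c) @[h --> 0^'] --> l by rewrite -lE.
move=> /cvgr_lt /(_ 0 l0) /nbhs_ballP[e/= e0 neg].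
have [xc cy] : x < c /\ c < y by move: cxy; rewrite in_itv/= => /andP.
(* If l < 0 then g1 < 0 just to the right of c, and g would decrease there. *)
have [h [h0 he hy]] : exists h, [/\ 0 < h, h < e & c + h < y].
  exists (Num.min e (y - c) / 2).
  by split; case: (leP e (y - c)) => ?; lra.
have sub : {subset `]c, (c + h)[ <= `]x, y[}.
  by move=> t; rewrite !in_itv/= => /andP[ct th]; apply/andP; split; lra.
have dgc t : t \in `[c, (c + h)] -> is_derive t 1 g (g1 t).
  rewrite in_itv/= => /andP[ct th]; apply: dg.
  by rewrite in_itv/=; apply/andP; split; lra.
have cch : c < c + h by rewrite ltrDl.
have dgo t : t \in `]c, (c + h)[ -> is_derive t 1 g (g1 t).
  by move=> /subset_itv_oo_cc /dgc.
have cg : {within `[c, (c + h)], continuous g}.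
  apply: derivable_within_continuous => t tch.
  by have [] := dgc t tch.
have [t tch E] := @MVT R g g1 c (c + h) cch dgo cg.
have := gmin (c + h); rewrite in_itv/= => /(_ ltac:(apply/andP; split; lra)) gch.
have : g1 t < 0.
  have [ct th] : c < t /\ t < c + h by move: tch; rewrite in_itv/= => /andP.
  have := neg (t - c); rewrite /ball/= sub0r normrN gtr0_norm; last lra.
  move=> /(_ ltac:(lra)) /(_ ltac:(lra)).
  rewrite g1c0 subr0 /GRing.scale/= mulr1 subrK.
  by rewrite pmulr_rlt0// invr_gt0; lra.
move=> g1t; have : g1 t * (c + h - c) < 0 by rewrite nmulr_rlt0//; lra.
by rewrite -E; lra.
Qed.

(** * The comparison function *)

(** The slope of this comparison function is m + K / t ^ 2 at 0, and falls to
about m as soon as s is large compared with t.  With K = L t ^ 2, that initial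
slope is m + L, while the barrier differs from the line m s by at most L t, so
that a small t makes the steep part negligible. *)
Definition barrier {R : realType} (m K t s : R) : R := m * s - K / (s + t).
Definition barrier_deriv {R : realType} (m K t s : R) : R := m + K / (s + t) ^+ 2.

Section Barrier.
Context {R : realType} (m K t : R) (t0 : 0 < t).

Lemma is_derive_barrier (s : R) : 0 <= s ->
  is_derive s 1 (barrier m K t) (barrier_deriv m K t s).
Proof.
move=> s0; have st : s + t != 0 by rewrite gt_eqF// ltr_wpDl.
rewrite /barrier /barrier_deriv; apply: is_derive_eq.
by rewrite /GRing.scale/=; field.
Qed.

Lemma is_derive_barrier_deriv (s : R) : 0 <= s ->
  is_derive s 1 (barrier_deriv m K t) (- (2 * K / (s + t) ^+ 3)).
Proof.
move=> s0; have st : s + t != 0 by rewrite gt_eqF// ltr_wpDl.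
have st2 : (s + t) ^+ 2 != 0 by rewrite expf_neq0.
rewrite /barrier_deriv; apply: is_derive_eq.
by rewrite /GRing.scale/=; field.
Qed.
End Barrier.

Lemma is_deriveB1 {R : realType} {f g : R -> R} {x df dg : R} :
  is_derive x 1 f df -> is_derive x 1 g dg -> is_derive x 1 (f \- g) (df - dg).
Proof. by move=> *; apply: is_deriveB. Qed.

(** The slopes of the barrier on [0, d] range over [m, m + L] and its second
derivative is at least -2 L / t, while f2 is smaller wherever f1 lies in that
range: f - barrier has no interior minimum.  Its minimum is not at d either, by
the hypothesis on f d.  It is therefore at 0, where its value is f 0 + L t. *)
Lemma barrier_le_diff (R : realType) (m L t d : R)
  (f f1 f2 : R -> R) :
  0 < L -> 0 < t -> 0 < d ->
  {within `[0, d], continuous f} ->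
  (forall s, s \in `]0, d[ -> is_derive s 1 f (f1 s)) ->
  (forall s, s \in `]0, d[ -> is_derive s 1 f1 (f2 s)) ->
  f 0 + L * t < f d - m * d ->
  (forall s, s \in `]0, d[ -> m <= f1 s <= m + L -> f2 s < - (2 * L / t)) ->
  forall s, s \in `[0, d] -> f 0 + L * t <= f s - barrier m (L * t ^+ 2) t s.
Proof.
move=> L0 t0 d0 fc df df1 fd eqf; set K := L * t ^+ 2.
have K0 : 0 < K by rewrite mulr_gt0// exprn_gt0.
pose g := f \- barrier m K t.
pose g1 := f1 \- barrier_deriv m K t.
have gc : {within `[0, d], continuous g}.
  move=> x; apply: continuousB; first exact: fc.
  move: x; apply: derivable_within_continuous => s.
  rewrite in_itv/= => /andP[s0 _].
  by have [] := is_derive_barrier m K t0 s0.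
have g0 : g 0 = f 0 + L * t.
  by rewrite /g/= /barrier /K; field; rewrite gt_eqF.
have [c cd cmin] := EVT_min (ltW d0) gc.
have [c0|c0] := eqVneq c 0.
  by move=> s /cmin; rewrite c0 g0.
have gd : g 0 < g d.
  rewrite g0; apply: (lt_le_trans fd); rewrite /g/= /barrier.
  have : 0 <= K / (d + t) by rewrite divr_ge0 ?addr_ge0 ?ltW.
  lra.
have {c0}{}cd : c \in `]0, d[.
  move: cd; rewrite !in_itv/= => /andP[c0' cd].
  rewrite lt_neqAle eq_sym c0 c0' /= lt_neqAle cd andbT.
  apply/eqP => cE; have := cmin 0; rewrite in_itv/= lexx (ltW d0) => /(_ isT).
  by rewrite cE leNgt gd.
have c0 : 0 < c by move: cd; rewrite in_itv/= => /andP[].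
have dg s : s \in `]0, d[ -> is_derive s 1 g (g1 s).
  move=> sd; apply: (is_deriveB1 (df _ sd)); apply: is_derive_barrier => //.
  by move: sd; rewrite in_itv/= => /andP[/ltW].
have dg1 := is_deriveB1 (df1 _ cd) (is_derive_barrier_deriv m K t0 (ltW c0)).
have [] := second_derivative_at_min cd dg dg1.
  by move=> s /subset_itv_oo_cc /cmin.
rewrite /g1/= /barrier_deriv => /subr0_eq f1c.
have ct : 0 < c + t by rewrite addr_gt0.
have KL : 0 <= K / (c + t) ^+ 2 <= L.
  rewrite ltW ?divr_gt0 ?exprn_gt0//= ler_pdivrMr ?exprn_gt0//.
  by rewrite ler_pM2l// lerXn2r ?nnegrE ?(ltW t0) ?(ltW ct)// lerDr ltW.
have := eqf c cd; rewrite f1c.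
have -> : m <= m + K / (c + t) ^+ 2 <= m + L by lra.
move=> /(_ isT).
have : 2 * K / (c + t) ^+ 3 <= 2 * L / t.
  rewrite ler_pdivrMr ?exprn_gt0// /K.
  have -> : 2 * L / t * (c + t) ^+ 3 = (2 * L) * ((c + t) ^+ 3 / t) by ring.
  rewrite mulrA ler_pM2l ?mulr_gt0// ler_pdivlMr//.
  by rewrite -exprSr lerXn2r ?nnegrE ?(ltW t0) ?(ltW ct)// lerDr ltW.
lra.
Qed.

(** * Slope amplification at the left end of an interval *)

(** The slope amplification described above.  In the comparison the barrier has
slopes from b + h down to a - h, where h is the margin by which F is negative
around [a, b]; only the part of size h * z / 8 of the gain h * z / 2 made by f
over the line of slope a - h on a base [0, z] is spent on the steep part of the
barrier, the rest absorbs the uniform error. *)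
Lemma right_derivative_gt_of_slope (R : realType) (d a b : R) (f : R -> R)
    (fn f1 f2 : nat -> R -> R) (eps : nat -> R) (F : R -> R -> R -> R) :
  0 < d -> a <= b ->
  (forall n, 0 < eps n) -> eps @ \oo --> (0 : R) ->
  (forall n, {within `[0, d], continuous fn n}) ->
  (forall n, (fn n s - fn n 0) / s @[s --> 0^'+] --> f1 n 0) ->
  (forall n s, s \in `]0, d[ -> is_derive s 1 (fn n) (f1 n s)) ->
  (forall n s, s \in `]0, d[ -> is_derive s 1 (f1 n) (f2 n s)) ->
  (forall n s, s \in `]0, d[ -> eps n * f2 n s = F s (fn n s) (f1 n s)) ->
  (forall e : R, 0 < e -> \forall n \near \oo,
     forall s, s \in `[0, d] -> `|fn n s - f s| < e) ->
  f @ 0^'+ --> f 0 ->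
  (forall k : R, 0 < k -> \forall s \near 0^'+, f 0 + (a - k) * s <= f s) ->
  (exists2 h : R, 0 < h & forall s r p, s \in `]0, d[ -> s < h -> `|r - f 0| < h ->
     a - h <= p <= b + h -> F s r p <= - h) ->
  \forall n \near \oo, b < f1 n 0.
Proof.
move=> d0 ab eps0 epsc fnc fn0 df df1 eqn unif f0c slope [h h0 Fneg].
have h20 : 0 < h / 2 by lra.
(* A base [0, z], chosen before n, on which the asymptotic lower bound holds
   with an error of slope h / 2. *)
have [z [z0 zd zh zP]] : exists z : R, [/\ 0 < z, z < d, z < h &
    forall s, 0 < s <= z -> `|f s - f 0| < h / 2 /\ f 0 + (a - h / 2) * s <= f s].
  have nr : \forall s \near 0^'+,
      `|f s - f 0| < h / 2 /\ f 0 + (a - h / 2) * s <= f s.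
    near=> s; split; last by near: s; exact: slope.
    near: s; move/cvgrPdist_lt: f0c => /(_ _ h20).
    by apply: filterS => s; rewrite distrC.
  have [e e0 nre] : exists2 e : R, 0 < e & forall s, 0 < s < e ->
      `|f s - f 0| < h / 2 /\ f 0 + (a - h / 2) * s <= f s.
    have [e/= e0 eP] := nr; exists e => // s /andP[s0 se].
    by apply: eP => //; rewrite /ball/= sub0r normrN gtr0_norm.
  pose w := Num.min e (Num.min d h).
  have w0 : 0 < w by rewrite !lt_min e0 d0 h0.
  have : w <= e /\ w <= d /\ w <= h by rewrite !ge_min !lexx ?orbT.
  move: w w0 => w w0 [we [wd wh]].
  exists (w / 2); split; [lra|lra|lra|move=> s /andP[s0 sw]].
  by apply: nre; apply/andP; split; lra.
set L := b - a + 2 * h; have L0 : 0 < L by rewrite /L; lra.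
set m := a - h.
have hz0 : 0 < h * z by rewrite mulr_gt0.
(* This t makes the steep part of the barrier contribute L * t = h * z / 8. *)
pose t := h * z / (8 * L).
have t0 : 0 < t by rewrite divr_gt0// mulr_gt0.
have Lt : L * t = h * z / 8 by rewrite /t; field; rewrite gt_eqF.
have B0 : 0 < 2 * L / t by apply: divr_gt0 => //; lra.
near=> n.
have close s : 0 <= s <= z -> `|fn n s - f s| < Num.min (h / 2) (h * z / 8).
  move=> /andP[s0 sz]; suff : s \in `[0, d].
    by move: s {s0 sz}; near: n; apply: unif; rewrite lt_min h20/=; lra.
  by rewrite in_itv/= s0/=; lra.
have epsn : eps n * (2 * L / t) < h.
  rewrite -ltr_pdivlMr//; near: n.
  by apply: (cvgr_lt _ epsc); exact: (divr_gt0 h0 B0).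
have sub s : s \in `]0, z[ -> s \in `]0, d[.
  by rewrite !in_itv/= => /andP[-> sz] /=; lra.
have low : forall s, s \in `[0, z] ->
    fn n 0 + L * t <= fn n s - barrier m (L * t ^+ 2) t s.
  apply: (barrier_le_diff L0 t0 z0 _ (f1 := f1 n) (f2 := f2 n)).
  - apply: continuous_subspaceW (fnc n) => s /=.
    by rewrite !in_itv/= => /andP[-> sz] /=; lra.
  - by move=> s /sub; apply: df.
  - by move=> s /sub; apply: df1.
  - have := close 0; rewrite lexx ltW// => /(_ isT).
    have := close z; rewrite lexx ltW// => /(_ isT).
    rewrite !lt_min => /andP[_ +] /andP[_ +].
    rewrite !ltr_norml => /andP[+ _] /andP[_ +].
    have [_] := zP z ltac:(rewrite z0 lexx//).
    by rewrite Lt /m => *; lra.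
  - move=> s sz f1s.
    have sd := sub _ sz.
    move: (sz); rewrite in_itv/= => /andP[s0 s_lt_z].
    have fns : `|fn n s - f 0| < h.
      have [fs _] := zP s ltac:(rewrite s0 ltW//).
      have := close s ltac:(rewrite !ltW//); rewrite lt_min => /andP[+ _].
      have := ler_distD (f s) (fn n s) (f 0); lra.
    have : eps n * f2 n s <= - h.
      rewrite eqn//; apply: Fneg => //; first lra.
      by move: f1s; rewrite /m /L => /andP[? ?]; apply/andP; split; lra.
    move=> le_h; rewrite ltNge; apply/negP => ge.
    have : eps n * (- (2 * L / t)) <= eps n * f2 n s by rewrite ler_pM2l.
    by rewrite mulrN; lra.
(* The barrier bounds the difference quotients of fn n at 0 from below; close to
   0 its own quotients exceed b + h / 2, since its slope at 0 is b + h. *)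
have bh : b < b + h / 2 by lra.
apply: (lt_le_trans bh).
apply: (ler_cvg_to (cvg_cst _) (fn0 n)); near=> s.
have s0 : 0 < s by [].
have Ls : L * s <= h / 2 * t.
  rewrite mulrC -ler_pdivlMr//; near: s; apply: nbhs_right_le.
  by rewrite divr_gt0// mulr_gt0.
have sz : s <= z by near: s; apply: nbhs_right_le.
have st : 0 < s + t by rewrite addr_gt0.
have y_ge : L - h / 2 <= L * (t / (s + t)).
  rewrite mulrA ler_pdivlMr//.
  have := mulr_gt0 h0 s0; lra.
rewrite ler_pdivlMr//.
have := low s; rewrite in_itv/= (ltW s0) sz => /(_ isT).
have -> : barrier m (L * t ^+ 2) t s = m * s + s * (L * (t / (s + t))) - L * t.
  by rewrite /barrier; field; rewrite gt_eqF.
move: y_ge; rewrite -(ler_pM2l s0) /m /L; lra.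
Unshelve. all: by end_near.
Qed.

(** * Derivatives relative to a set, along a direction *)

Lemma cvg_affine (R : realType) (A : set R) (y0 c : R) (F : set_system R)
    {FF : Filter F} :
  c != 0 -> F --> 0^' -> (\forall s \near F, A (y0 + c * s)) ->
  (y0 + c * s) @[s --> F] --> within A (y0^').
Proof.
move=> c0 F0 FA P /nbhs_ballP[e/= e0 eP].
have F0e : F [set s | ball 0 (e / `|c|) s /\ s != 0].
  have ec : 0 < e / `|c| by rewrite divr_gt0 ?normr_gt0.
  by apply: F0; apply: filterS (dnbhs_ball 0 ec) => s [bs /eqP s0].
rewrite nbhs_filterE /fmap/=; apply: filterS2 FA F0e => s As [bs s0].
apply: eP => //.
  move: bs; rewrite /ball/= sub0r normrN ltr_pdivlMr ?normr_gt0// => bs.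
  by rewrite opprD addrA subrr sub0r normrN normrM mulrC.
by rewrite -subr_eq0 addrAC subrr add0r mulf_neq0.
Qed.

Lemma deriv_in_quotient (R : realType) (A : set R) (f : R -> R) (y0 c : R)
    (F : set_system R) {FF : ProperFilter F} :
  c != 0 -> F --> 0^' -> (\forall s \near F, A (y0 + c * s)) ->
  derivable_in A f y0 ->
  (f (y0 + c * s) - f y0) / s @[s --> F] --> c * deriv_in A f y0.
Proof.
move=> c0 F0 FA dfy.
have q : c * ((f (y0 + c * s) - f y0) / (y0 + c * s - y0)) @[s --> F] -->
    c * deriv_in A f y0.
  apply: cvgMl_tmp.
  exact: (cvg_comp _ (fun z => (f z - f y0) / (z - y0)) (cvg_affine c0 F0 FA) dfy).
apply: cvg_trans q; apply: near_eq_cvg.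
near=> s.
have s0 : s != 0 by near: s; apply: F0; exact: withinT.
rewrite /= [y0 + _]addrC addrK.
by field; rewrite s0 c0.
Unshelve. all: by end_near.
Qed.

Lemma is_derive_deriv_in (R : realType) (A : set R) (f : R -> R) (y0 c t s : R) :
  c != 0 -> nbhs (y0 + c * s) A -> derivable_in A f (y0 + c * s) ->
  is_derive s 1 (fun s => t * f (y0 + c * s)) (t * (c * deriv_in A f (y0 + c * s))).
Proof.
move=> c0 nA dfy.
suff dq : h^-1 *: (t * f (y0 + c * (h *: 1 + s)) - t * f (y0 + c * s)) @[h --> 0^']
    --> t * (c * deriv_in A f (y0 + c * s)).
  by apply: DeriveDef; [apply/cvg_ex; eexists; exact: dq|exact/cvg_lim].
have Ah : \forall h \near 0^', A (y0 + c * s + c * h).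
  apply: cvg_within.
  have cc : {for 0, continuous (fun h : R => y0 + c * s + c * h)}.
    by move=> h; apply: cvgD; [exact: cvg_cst|apply: cvgMl_tmp; exact: cvg_id].
  by apply: cc; rewrite mulr0 addr0.
have q : t * ((f (y0 + c * s + c * h) - f (y0 + c * s)) / h) @[h --> 0^'] -->
    t * (c * deriv_in A f (y0 + c * s)).
  by apply: cvgMl_tmp; exact: deriv_in_quotient.
apply: cvg_trans q; apply: near_eq_cvg; near=> h.
rewrite /GRing.scale/= mulr1.
have -> : y0 + c * (h + s) = y0 + c * s + c * h by ring.
by ring.
Unshelve. all: by end_near.
Qed.

(** * Slope amplification along an edge *)

(** Tube lemma: strict negativity on the segment {(y0, r0)} * [a, b] extends,
by compactness, to a neighborhood of the whole segment with a uniform margin.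
The slopes are read as c * p because an edge may be run in either direction. *)
Lemma negative_tube (R : realType) (A : set R) (G : R -> R -> R -> R)
    (y0 r0 a b t c : R) :
  A y0 -> `|c| = 1 -> a <= b ->
  {within A `*` [set: R] `*` [set: R],
    continuous (fun z : R * R * R => G z.1.1 z.1.2 z.2)} ->
  (forall p, a <= p <= b -> t * G y0 r0 (c * p) < 0) ->
  exists2 h : R, 0 < h & forall y r p, A y -> `|y - y0| < h -> `|r - r0| < h ->
    a - h <= p <= b + h -> t * G y r (c * p) <= - h.
Proof.
move=> Ay0 c1 ab Gc Gneg.
(* The radius 2 * e in p lets the covered segment [a, b] be enlarged by e. *)
pose P (e x : R) := forall y r p, A y -> `|y - y0| < e -> `|r - r0| < e ->
  `|p - x| < 2 * e -> t * G y r (c * p) <= - e.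
have cov : \forall e \near 0^'+, `[a, b] `<=` P e.
  apply: ((compact_near_coveringP _).1 (@segment_compact R a b)).
  move=> x; rewrite /= in_itv/= => xab.
  have g0 := Gneg x xab; set g := t * G y0 r0 (c * x) in g0.
  have Gx : t * G z.1.1 z.1.2 z.2 @[z -->
      within (A `*` [set: R] `*` [set: R]) (nbhs (y0, r0, c * x))] --> g.
    by apply: cvgMl_tmp; have /subspace_continuousP := Gc; apply.
  have : g < g / 2 by lra.
  move=> /(cvgr_lt _ Gx).
  move=> /nbhs_ballP[e/= e0 eP].
  exists (ball x (e / 4), [set h | 0 < h /\ h < e / 4 /\ h < - g / 2]).
    split => /=; first by apply: nbhsx_ballx; lra.
    near=> h; split; [by []|split; near: h; apply: nbhs_right_lt; lra].
  move=> [x' h] /= [xx' [h0 [he hg]]] y r p Ay yy rr pp.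
  have -> : G y r (c * p) = G (y, r, c * p).1.1 (y, r, c * p).1.2 (y, r, c * p).2 by [].
  apply: ltW; apply: (@lt_trans _ _ (g / 2)); last by lra.
  apply: eP => //.
  split; first split => /=; rewrite /ball/= distrC; [lra|lra|].
  rewrite -mulrBr normrM c1 mul1r.
  move: xx'; rewrite /ball/= distrC => xx'.
  by have := ler_distD x' p x; lra.
have [e/= e0 eP] := cov.
exists (e / 2); first by lra.
move=> y r p Ay yy rr /andP[pa pb].
have Pe := eP (e / 2) ltac:(rewrite /ball/= sub0r normrN gtr0_norm; lra) ltac:(lra).
have [x xab px] : exists2 x, a <= x <= b & `|p - x| < 2 * (e / 2).
  have [pa'|pa'] := leP p a.
    by exists a; rewrite ?lexx// ler0_norm; lra.
  have [pb'|pb'] := leP p b.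
    by exists p; rewrite ?pb' ?(ltW pa')// subrr normr0; lra.
  by exists b; rewrite ?lexx ?ab// gtr0_norm; lra.
by apply: (Pe x) => //=; rewrite in_itv.
Unshelve. all: by end_near.
Qed.

Lemma at_right_dnbhs (R : realType) (x : R) : x^'+ --> x^'.
Proof.
by move=> P [e e0 eP]; exists e => // s bs xs; apply: eP => //; rewrite gt_eqF.
Qed.

Lemma cvg_affine_within (R : realType) (A B : set R) (y0 c s0 : R) :
  (\forall s \near s0, B s -> A (y0 + c * s)) ->
  (y0 + c * s) @[s --> within B (nbhs s0)] --> within A (nbhs (y0 + c * s0)).
Proof.
move=> BA P nP.
have cc : {for s0, continuous (fun s : R => y0 + c * s)}.
  by apply: cvgD; [exact: cvg_cst|apply: cvgMl_tmp; exact: cvg_id].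
have nP' : \forall s \near s0, A (y0 + c * s) -> P (y0 + c * s) by exact: cc _ nP.
rewrite /fmap/= /within/=.
by apply: filterS2 BA nP' => s BA AP Bs; apply: AP; exact: BA.
Qed.

(** Slope amplification at y0 in the direction c, for t times the functions:
with s the distance to y0, the functions s |-> t * vn n (y0 + c * s) solve an
equation of the same form, where F(s, r, p) = t * G(y0 + c s, t r, t c p). *)
Lemma directed_derivative_gt_of_slope (R : realType) (l d y0 c t a b : R)
    (G : R -> R -> R -> R) (v : R -> R) (vn : nat -> R -> R) (eps : nat -> R) :
  c * c = 1 -> t * t = 1 -> 0 < d ->
  (forall s, s \in `[0, d] -> y0 + c * s \in `[0, l]) -> a <= b ->
  (forall n, 0 < eps n) -> eps @ \oo --> (0 : R) ->
  (forall n, Ck_in `[0, l]%classic 2 (vn n)) ->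
  (forall n y, y \in `]0, l[ -> - eps n * derivn_in `[0, l]%classic 2 (vn n) y +
     G y (vn n y) (deriv_in `[0, l]%classic (vn n) y) = 0) ->
  (forall e : R, 0 < e -> \forall n \near \oo,
     forall y, y \in `[0, l] -> `|vn n y - v y| < e) ->
  {within `[0, l], continuous v} ->
  {within `[0, l] `*` [set: R] `*` [set: R],
    continuous (fun z : R * R * R => G z.1.1 z.1.2 z.2)} ->
  (forall p, a <= p <= b -> t * G y0 (v y0) (t * c * p) < 0) ->
  (forall k : R, 0 < k ->
     \forall s \near 0^'+, t * v y0 + (a - k) * s <= t * v (y0 + c * s)) ->
  \forall n \near \oo, b < t * c * deriv_in `[0, l]%classic (vn n) y0.
Proof.
move=> cc tt d0 yl ab eps0 epsc vnC vnE unif vc Gc Gneg slope.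
set A := `[0, l]%classic in vnC vnE vc Gc *.
have c0 : c != 0 by apply/eqP => cE; move: cc; rewrite cE mul0r; lra.
have tc1 : `|t * c| = 1.
  by apply/eqP; rewrite -sqr_norm_eq1 expr2 mulrACA tt cc mul1r.
have t1 : `|t| = 1.
  by apply/eqP; rewrite -sqr_norm_eq1 expr2 tt.
have c1 : `|c| = 1.
  by apply/eqP; rewrite -sqr_norm_eq1 expr2 cc.
have Ay0 : A y0.
  by have := yl 0; rewrite /A/= mulr0 addr0; apply; rewrite in_itv/= lexx ltW.
have yo s : s \in `]0, d[ -> y0 + c * s \in `]0, l[.
  have := yl 0; have := yl d; rewrite !in_itv/= !lexx (ltW d0) mulr0 addr0.
  move=> /(_ isT)/andP[yd0 ydl] /(_ isT)/andP[y00 y0l] /andP[s0 sd].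
  move/eqP: cc; rewrite -expr2 sqrf_eq1 => /orP[]/eqP cE; rewrite cE in yd0 ydl *;
  apply/andP; split; lra.
have yA s : s \in `]0, d[ -> nbhs (y0 + c * s) A.
  move=> /yo yso; rewrite /A; apply: (filterS (@subset_itv_oo_cc _ _ _ _)).
  exact: near_in_itvoo.
have [h h0 hP] := negative_tube Ay0 tc1 ab Gc Gneg.
pose f s := t * v (y0 + c * s).
pose fn n s := t * vn n (y0 + c * s).
pose f1 n s := t * (c * deriv_in A (vn n) (y0 + c * s)).
pose f2 n s := t * derivn_in A 2 (vn n) (y0 + c * s).
pose F s r p := t * G (y0 + c * s) (t * r) (t * c * p).
suff : \forall n \near \oo, b < f1 n 0.
  by apply: filterS => n; rewrite /f1 mulr0 addr0 mulrA.
have derA n y : A y -> derivable_in A (vn n) y by case: (vnC n) => dv _; exact: (dv 0%N).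
have derA1 n y : A y -> derivable_in A (deriv_in A (vn n)) y.
  by case: (vnC n) => dv _; exact: (dv 1%N).
have yA0 s : s \in `]0, d[ -> A (y0 + c * s) by move=> /yA /nbhs_singleton.
have nA0 : \forall s \near 0^'+, A (y0 + c * s).
  by near=> s; apply: yA0; rewrite in_itv/=; apply/andP; split=> //.
apply: (@right_derivative_gt_of_slope R d a b f fn f1 f2 eps F) => //.
- move=> n; apply/subspace_continuousP => s sd; apply: cvgMl_tmp.
  case: (vnC n) => _ /(_ 0%N isT)/subspace_continuousP/= vnc.
  apply: cvg_comp (vnc _ (yl _ sd)); apply: cvg_affine_within.
  by exists 1 => //= r _; exact: yl.
- move=> n.
  have -> : (fun s => (fn n s - fn n 0) / s) =
      (fun s => t * ((vn n (y0 + c * s) - vn n y0) / s)).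
    by apply/funext => s; rewrite /fn mulr0 addr0 mulrA mulrBr.
  rewrite /f1 mulr0 addr0; apply: cvgMl_tmp.
  apply: (@deriv_in_quotient _ A (vn n) y0 c 0^'+ _ c0 _ nA0 (derA n _ Ay0)).
  exact: at_right_dnbhs.
- by move=> n s sd; apply: is_derive_deriv_in; [|exact: yA|exact/derA/yA0].
- move=> n s sd.
  have -> : f1 n = (fun s => (t * c) * deriv_in A (vn n) (y0 + c * s)).
    by apply/funext => r; rewrite /f1 mulrA.
  have -> : f2 n s = t * c * (c * deriv_in A (deriv_in A (vn n)) (y0 + c * s)).
    by rewrite /f2 mulrA -(mulrA t) cc mulr1.
  by apply: is_derive_deriv_in; [|exact: yA|exact/derA1/yA0].
- move=> n s sd; have := vnE n _ (yo _ sd).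
  rewrite /F /fn /f1 /f2 (mulrA t t) tt mul1r.
  set D := deriv_in _ _ _.
  have -> : t * c * (t * (c * D)) = (t * t) * (c * c) * D by ring.
  rewrite tt cc !mul1r.
  set X := derivn_in _ _ _ _; set Y := G _ _ _ => XY.
  have -> : Y = eps n * X by lra.
  by ring.
- move=> e e0; apply: filterS (unif e e0) => n un s /yl /un.
  by rewrite /fn /f -mulrBr normrM t1 mul1r.
- rewrite /f; apply: cvgMl_tmp; move/subspace_continuousP : vc => /(_ _ Ay0) vc.
  rewrite mulr0 addr0.
  have q := cvg_affine_within (A := A) (B := [set s | 0 < s]) (y0 := y0) (c := c) (s0 := 0).
  by apply: cvg_comp vc; rewrite mulr0 addr0 in q; apply: q.
- by move=> k /slope; rewrite /f mulr0 addr0.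
- exists h => // s r p sd sh rf pab; rewrite /F; apply: hP => //.
  + exact: yA0.
  + by rewrite addrAC subrr add0r normrM c1 mul1r gtr0_norm//; move: sd; rewrite in_itv/= => /andP[].
  + by move: rf; rewrite /f mulr0 addr0 -[r in `|r - _|]mul1r -tt -mulrA -mulrBr normrM t1 mul1r.
Unshelve. all: by end_near.
Qed.

(** When phi touches v at y0, the function v inherits from phi, in the direction
c, a line that bounds it to first order. *)
Lemma touching_slope (R : realType) (A : set R) (v phi : R -> R) (y0 c t : R) :
  c != 0 -> (\forall s \near 0^'+, A (y0 + c * s)) -> derivable_in A phi y0 ->
  (\forall y \near within A (nbhs y0), t * (v y0 - phi y0) <= t * (v y - phi y)) ->
  forall k : R, 0 < k -> \forall s \near 0^'+,
    t * v y0 + (t * c * deriv_in A phi y0 - k) * s <= t * v (y0 + c * s).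
Proof.
move=> c0 nA dphi touch k k0.
have q : t * ((phi (y0 + c * s) - phi y0) / s) @[s --> 0^'+] -->
    t * (c * deriv_in A phi y0).
  by apply: cvgMl_tmp; apply: deriv_in_quotient => //; exact: at_right_dnbhs.
have near_touch : \forall s \near 0^'+,
    t * (v y0 - phi y0) <= t * (v (y0 + c * s) - phi (y0 + c * s)).
  have := @cvg_affine_within R A [set s | 0 < s] y0 c 0 nA.
  by rewrite mulr0 addr0 => /(_ _ touch).
near=> s; have s0 : 0 < s by [].
have : t * c * deriv_in A phi y0 - k < t * ((phi (y0 + c * s) - phi y0) / s).
  by near: s; apply: (cvgr_gt _ q); rewrite -mulrA; lra.
rewrite mulrA ltr_pdivlMr//.
have : t * (v y0 - phi y0) <= t * (v (y0 + c * s) - phi (y0 + c * s)).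
  by near: s; exact: near_touch.
lra.
Unshelve. all: by end_near.
Qed.

(** * Edges and vertices of a network *)

Section NetworkGeometry.
Context {R : realType} {n : nat} (N : network_data R n) (netN : is_network N).
Implicit Types (i : vidx N) (j k : eidx N) (y : R) (f phi : 'rV[R]_n -> R).

Lemma edge_coordK j y : param j y -> edge_coord j (crv j y) = y.
Proof.
by move=> jy; apply: (pinvKV _ (@crv_inj _ _ _ netN j)); rewrite inE.
Qed.

(** The parametrization is continuous, because its coordinates are smooth; this
turns extrema relative to the network into extrema along an edge. *)
Lemma near_along_edge j y (S : set 'rV[R]_n) (P : 'rV[R]_n -> Prop) :
  cedge j `<=` S -> param j y ->
  (\forall x \near within S (nbhs (crv j y)), P x) ->
  \forall z \near within (param j) (nbhs y), P (crv j z).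
Proof.
move=> jS jy /nbhs_ballP[e/= e0 eP].
have cc (c : 'I_n) : \forall z \near within (param j) (nbhs y),
    ball (crv j y ord0 c) e (crv j z ord0 c).
  have [_ /(_ 0%N isT)/subspace_continuousP/= ccont] := crv_smooth netN j c 0.
  exact: (ccont y jy _ (nbhsx_ballx (crv j y ord0 c) e e0)).
have near_all := filter_forall _ cc.
near=> z.
apply: (eP (crv j z)).
  split=> // a c; rewrite ord1; move: c; near: z; exact: near_all.
by apply: jS; exists z => //; near: z; exact: withinT.
Unshelve. all: by end_near.
Qed.

Lemma param0 j : param j 0.
Proof. by rewrite /param/= in_itv/= lexx ltW// (len_gt0 netN). Qed.

Lemma param_len j : param j (len j).
Proof. by rewrite /param/= in_itv/= lexx ltW// (len_gt0 netN). Qed.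

Lemma crv_endpoints_neq j : crv j 0 <> crv j (len j).
Proof.
move=> /(crv_inj netN); rewrite !inE => /(_ (param0 j) (param_len j)) E.
by have := len_gt0 netN j; rewrite -E ltxx.
Qed.

(** The two endpoints are distinct vertices on the closed edge, which carries
only two vertices; a third one would inject three points into two. *)
Lemma vertex_endpoint j x : cedge j x -> vertices N x ->
  x = crv j 0 \/ x = crv j (len j).
Proof.
move=> jx Vx; have := cedge_vertices netN j.
rewrite card_eq_le => /andP[/pcard_leP[f] _].
have S0 : (cedge j `&` vertices N) (crv j 0).
  by split; [exists 0 => //; exact: param0|exact: (crv_start netN j)].
have S1 : (cedge j `&` vertices N) (crv j (len j)).
  by split; [exists (len j) => //; exact: param_len|exact: (crv_end netN j)].
have Sx : (cedge j `&` vertices N) x by [].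
have finj a b : (cedge j `&` vertices N) a -> (cedge j `&` vertices N) b ->
    f a = f b -> a = b.
  by move=> Sa Sb; apply: inj; rewrite inE.
have f2 a : (cedge j `&` vertices N) a -> (f a < 2)%N.
  by move=> /(@funS _ _ _ _ f).
have := f2 _ S0; have := f2 _ S1; have := f2 _ Sx.
have f01 : f (crv j 0) <> f (crv j (len j)).
  by move=> /(finj _ _ S0 S1); exact: crv_endpoints_neq.
have [E|/eqP x0] := eqVneq (f x) (f (crv j 0)); first by left; exact: finj E.
have [E|/eqP x1] := eqVneq (f x) (f (crv j (len j))); first by right; exact: finj E.
move: f01 x0 x1.
by case: (f x) => [|[|?]]; case: (f (crv j 0)) => [|[|?]]; case: (f (crv j (len j))) => [|[|?]].
Qed.

Lemma inc_endpoint i j : j \in inc i ->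
  (vtx i = crv j 0 /\ a_ i j = 1) \/ (vtx i = crv j (len j) /\ a_ i j = -1).
Proof.
rewrite inE => /asboolP ji.
have [iE|iE] := vertex_endpoint ji (ex_intro2 _ _ i I erefl).
  by left; rewrite /a_ iE eqxx.
right; rewrite /a_ iE eqxx ifF//.
by apply/eqP => /esym; exact: crv_endpoints_neq.
Qed.

End NetworkGeometry.

(** * Touching test functions *)

Section VanishingViscosity.
Context {R : realType} {n : nat} (N : network_data R n) (netN : is_network N).
Context (beta : vidx N -> eidx N -> R) (g : vidx N -> R) (H : hamiltonian N).
Context (H_cont : forall j,
     {within param j `*` [set: R] `*` [set: R],
       continuous (fun z : R * R * R => H j z.1.1 z.1.2 z.2)}).
Context (eps : nat -> R) (eps_gt0 : forall m, 0 < eps m).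
Context (eps_cvg0 : eps @ \oo --> (0 : R)).
Context (un : nat -> 'rV[R]_n -> R) (un_C2 : forall m, Ck_star beta 2 (un m)).
Context (un_sol : forall m, viscous_solution (eps m) beta g H (un m)).
Context (u : 'rV[R]_n -> R) (u_C0 : C0 N u).
Context (un_cvg : {uniform Gamma N, un @ \oo --> u}).
Implicit Types (i : vidx N) (j k : eidx N).

Lemma der_crv j y f : param j y ->
  der j f (crv j y) = deriv_in (param j) (on_edge f j) y.
Proof. by move=> jy; rewrite /der /dern edge_coordK. Qed.

Lemma H_at_crv j y phi : param j y ->
  H_at H j u phi (crv j y) =
  H j y (on_edge u j y) (deriv_in (param j) (on_edge phi j) y).
Proof. by move=> jy; rewrite /H_at der_crv// edge_coordK. Qed.

Lemma uniform_along_edge j (e : R) : 0 < e -> \forall m \near \oo,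
  forall y, y \in `[0, len j] -> `|on_edge (un m) j y - on_edge u j y| < e.
Proof.
move=> e0.
have : nbhs (u : {uniform` Gamma N -> R})
    [set h | forall x, Gamma N x -> `|h x - u x| < e].
  apply/uniform_nbhs; exists [set z : R * R | `|z.2 - z.1| < e]; split.
    rewrite -entourage_ballE; exists e => // z /=.
    by rewrite /ball/= distrC.
  by [].
move=> /un_cvg near_un; near=> m => y yj.
have um : forall x, Gamma N x -> `|un m x - u x| < e by near: m; exact: near_un.
by apply: um; exists j => //; exists y.
Unshelve. all: by end_near.
Qed.

Lemma on_edge_continuous j : {within param j, continuous (on_edge u j)}.
Proof.
apply/subspace_continuousP => y jy P /=.
have Gy : Gamma N (crv j y) by exists j => //; exists y.
have /subspace_continuousP uc := u_C0.
move=> /(uc _ Gy); apply: near_along_edge => //.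
by move=> x jx; exists j.
Qed.

Lemma edge_equation m j y : y \in `]0, len j[ ->
  - eps m * derivn_in (param j) 2 (on_edge (un m) j) y +
    H j y (on_edge (un m) j y) (deriv_in (param j) (on_edge (un m) j) y) = 0.
Proof.
move=> yj; have jy : param j y by exact: (subset_itv_oo_cc yj).
have [eqn _ _] := un_sol m.
have := eqn j (crv j y) (ex_intro2 _ _ y yj erefl).
by rewrite /der /dern edge_coordK.
Qed.

Lemma edge_derivative_gt_of_slope j (d y0 c t a b : R) :
  c * c = 1 -> t * t = 1 -> 0 < d ->
  (forall s, s \in `[0, d] -> y0 + c * s \in `[0, len j]) -> a <= b ->
  (forall p, a <= p <= b -> t * H j y0 (on_edge u j y0) (t * c * p) < 0) ->
  (forall e : R, 0 < e -> \forall s \near 0^'+,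
     t * on_edge u j y0 + (a - e) * s <= t * on_edge u j (y0 + c * s)) ->
  \forall m \near \oo, b < t * c * deriv_in (param j) (on_edge (un m) j) y0.
Proof.
move=> cc tt d0 yl ab Hneg slope.
apply: (@directed_derivative_gt_of_slope R (len j) d y0 c t a b (H j) (on_edge u j)
  (fun m => on_edge (un m) j) eps) => //.
- by move=> m; have [[_ uC2] _] := un_C2 m; exact: uC2.
- by move=> m y yj; exact: edge_equation.
- exact: uniform_along_edge.
- exact: on_edge_continuous.
- exact: H_cont.
Qed.

(** For t = 1 and t = -1 this is the supersolution, respectively subsolution,
inequality inside an edge.  If it failed, slope amplification from x in both
directions would make t times the derivative of un m at x both larger and
smaller than t times that of phi. *)
Lemma interior_touching j x phi (t : R) : t * t = 1 -> edge j x ->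
  test_edge j x phi ->
  (\forall z \near within (Gamma N) (nbhs x),
     t * (u x - phi x) <= t * (u z - phi z)) ->
  0 <= t * H_at H j u phi x.
Proof.
move=> tt [y0 yj <-{x}] [_]; have jy : param j y0 by exact: (subset_itv_oo_cc yj).
rewrite H_at_crv// edge_coordK//.
move: yj; rewrite /= in_itv/= => /andP[y00 y0l].
set p := deriv_in _ (on_edge phi j) _ => dphi touch.
have {}touch : \forall z \near within (param j) (nbhs y0),
    t * (on_edge u j y0 - on_edge phi j y0) <= t * (on_edge u j z - on_edge phi j z).
  by apply: near_along_edge touch => // x jx; exists j.
rewrite leNgt; apply/negP => Hneg.
pose d := Num.min y0 (len j - y0).
have d0 : 0 < d by rewrite lt_min y00 subr_gt0.
have [dl dr] : d <= y0 /\ d <= len j - y0 by rewrite !ge_min !lexx orbT.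
have slopes (c : R) : c * c = 1 -> \forall m \near \oo,
    t * c * p < t * c * deriv_in (param j) (on_edge (un m) j) y0.
  move=> cc; have c0 : c != 0 by apply/eqP => cE; move: cc; rewrite cE mul0r; lra.
  have yl s : s \in `[0, d] -> y0 + c * s \in `[0, len j].
    rewrite !in_itv/= => /andP[s0 sd].
    move/eqP: cc; rewrite -expr2 sqrf_eq1 => /orP[]/eqP ->;
    apply/andP; split; lra.
  apply: (edge_derivative_gt_of_slope (d := d) (a := t * c * p)) => //.
    move=> q /andP[q1 q2]; have -> : q = t * c * p by lra.
    have -> : t * c * (t * c * p) = (t * t) * (c * c) * p by ring.
    by rewrite tt cc !mul1r.
  apply: touching_slope => //.
  near=> s; apply: yl; rewrite in_itv/=; apply/andP; split=> //.
  by near: s; exact: nbhs_right_le.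
have [m [sp sm]] : exists m, t * 1 * p < t * 1 * deriv_in (param j) (on_edge (un m) j) y0
   /\ t * -1 * p < t * -1 * deriv_in (param j) (on_edge (un m) j) y0.
  apply: (@filter_ex _ \oo); near=> m; split; near: m; apply: slopes; lra.
by move: sp sm; lra.
Unshelve. all: by end_near.
Qed.

(** The sign a_ i j is the direction that enters the edge at the vertex: moving
from the parameter of the vertex by a_ i j * s stays on the edge. *)
Lemma inc_coord i j : j \in inc i ->
  [/\ param j (edge_coord j (vtx i)), vtx i = crv j (edge_coord j (vtx i)),
      a_ i j * a_ i j = 1 &
      forall s, s \in `[0, len j] -> edge_coord j (vtx i) + a_ i j * s \in `[0, len j]].
Proof.
move=> ij; have [[-> ->]|[-> ->]] := inc_endpoint netN ij.
  rewrite edge_coordK//; last exact: param0.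
  by split; [exact: param0|by []|lra|move=> s; rewrite add0r mul1r].
rewrite edge_coordK//; last exact: param_len.
split; [exact: param_len|by []|lra|move=> s].
by rewrite !in_itv/= => /andP[s0 sl]; apply/andP; split; lra.
Qed.

(** Slope amplification at a vertex, along the edge j.  A slope a below the one
inherited from the test function is allowed, since only the lower bound on u
matters. *)
Lemma vertex_derivative_gt_of_slope i j (phi : 'rV[R]_n -> R) (S : set 'rV[R]_n) (t a b : R) :
  let p := der j phi (vtx i) in
  j \in inc i -> t * t = 1 -> cedge j `<=` S ->
  derivable_in (param j) (on_edge phi j) (edge_coord j (vtx i)) ->
  (\forall z \near within S (nbhs (vtx i)),
     t * (u (vtx i) - phi (vtx i)) <= t * (u z - phi z)) ->
  a <= t * a_ i j * p -> a <= b ->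
  (forall q, a <= t * a_ i j * q <= b ->
     t * H j (edge_coord j (vtx i)) (on_edge u j (edge_coord j (vtx i))) q < 0) ->
  \forall m \near \oo, b < t * a_ i j * der j (un m) (vtx i).
Proof.
move=> p ij tt jS; rewrite {}/p; have [jy iE cc yl] := inc_coord ij.
move: (edge_coord j (vtx i)) (a_ i j) => y0 c in jy iE cc yl *.
rewrite iE => dphi touch; rewrite der_crv// => ap ab Hneg.
have c0 : c != 0 by apply/eqP => cE; move: cc; rewrite cE mul0r; lra.
have l0 := len_gt0 netN j.
have {}touch : \forall z \near within (param j) (nbhs y0),
    t * (on_edge u j y0 - on_edge phi j y0) <= t * (on_edge u j z - on_edge phi j z).
  exact: (near_along_edge netN jS jy touch).
have : \forall m \near \oo,
    b < t * c * deriv_in (param j) (on_edge (un m) j) y0.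
  apply: (edge_derivative_gt_of_slope (d := len j) (a := a)) => //.
    move=> q qab; apply: Hneg.
    have -> : t * c * (t * c * q) = (t * t) * (c * c) * q by ring.
    by rewrite tt cc !mul1r.
  have near_yl : \forall s \near 0^'+, param j (y0 + c * s).
    near=> s; apply: yl; rewrite in_itv/=; apply/andP; split=> //.
    by near: s; exact: nbhs_right_le.
  move=> e e0; have := touching_slope c0 near_yl dphi touch e0.
  move=> tslope; near=> s.
  have s0 : 0 < s by [].
  have : t * on_edge u j y0 + (t * c * deriv_in (param j) (on_edge phi j) y0 - e) * s
      <= t * on_edge u j (y0 + c * s) by near: s; exact: tslope.
  apply: le_trans; rewrite lerD2l ler_pM2r//; lra.
by apply: filterS => m; rewrite der_crv.
Unshelve. all: by end_near.
Qed.

Context (H_mono_p : forall i j r, i \in trans N -> j \in inc i ->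
     {in `]0, +oo[ &, {homo H j (edge_coord j (vtx i)) r : p q / p <= q}}).
Context (H_even : forall i j r p, i \in trans N -> j \in inc i ->
     H j (edge_coord j (vtx i)) r p = H j (edge_coord j (vtx i)) r (- p)).

(** By evenness both slopes may be taken nonnegative.  Monotonicity is assumed
only on positive slopes, and reaches the slope 0 by continuity. *)
Lemma hamiltonian_norm_le i j r p q : i \in trans N -> j \in inc i ->
  `|p| <= `|q| ->
  H j (edge_coord j (vtx i)) r p <= H j (edge_coord j (vtx i)) r q.
Proof.
move=> iT ij; have [jy _ _ _] := inc_coord ij.
have Habs s : H j (edge_coord j (vtx i)) r s = H j (edge_coord j (vtx i)) r `|s|.
  by case: (ger0P s) => // _; exact: H_even.
rewrite (Habs p) (Habs q); move: `|p| `|q| (normr_ge0 p) => {}p {}q p0 pq.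
have [pp|pp] := ltP 0 p.
  by apply: H_mono_p => //; rewrite in_itv/= andbT//; exact: lt_le_trans pq.
have {pp p0} pE : p = 0 by apply/eqP; rewrite eq_le p0 pp.
rewrite {p}pE in pq *.
have [q0|q0] := leP q 0; first by have -> : q = 0 by apply/eqP; rewrite eq_le q0.
set y0 := edge_coord j (vtx i) in jy *.
have Hc : H j y0 r s @[s --> 0^'+] --> H j y0 r 0.
  move=> P /= nP; have /subspace_continuousP/(_ (y0, r, 0)) := @H_cont j.
  move=> /(_ ltac:(by []) P nP)/nbhs_ballP[e/= e0 eP].
  exists e => //= s bs s0; apply: (eP (y0, r, s)) => //.
  by split => //; split; exact: ballxx.
have near_le : \forall s \near 0^'+, H j y0 r s <= H j y0 r q.
  near=> s; apply: H_mono_p => //; rewrite ?in_itv/= ?andbT//.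
  by near: s; exact: nbhs_right_le.
by apply: (ler_cvg_to Hc (cvg_cst _)).
Unshelve. all: by end_near.
Qed.

Lemma norm_a_ i j x : j \in inc i -> `|a_ i j * x| = `|x|.
Proof.
move=> /inc_coord[_ _ cc _]; rewrite normrM.
suff -> : `|a_ i j| = 1 by rewrite mul1r.
by apply/eqP; rewrite -sqr_norm_eq1 expr2 cc.
Qed.

(** Along an edge on which phi descends from the vertex, -u lies above a line of
slope a >= 0.  If H were positive at that slope, it would be so at all steeper
ones, and amplification up to b = max a M would break the gradient bound M. *)
Lemma subsolution_descending_edge i j (phi : 'rV[R]_n -> R) (S : set 'rV[R]_n) (M : R) :
  (forall m x, cedge j x -> `|der j (un m) x| <= M) ->
  i \in trans N -> j \in inc i -> cedge j `<=` S ->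
  derivable_in (param j) (on_edge phi j) (edge_coord j (vtx i)) ->
  local_max_on S (u \- phi) (vtx i) -> a_ i j * der j phi (vtx i) <= 0 ->
  H_at H j u phi (vtx i) <= 0.
Proof.
move=> dM iT ij jS dphi touch desc.
have [jy iE cc _] := inc_coord ij.
have norm_a x := norm_a_ x ij.
rewrite leNgt; apply/negP => Hpos.
set p := der j phi (vtx i) in desc.
pose a := -1 * a_ i j * p.
have slope : \forall m \near \oo,
    Num.max a M < -1 * a_ i j * der j (un m) (vtx i).
  apply: (vertex_derivative_gt_of_slope (phi := phi) (S := S) (a := a)) => //; first lra.
  - by apply: filterS touch => z /=; lra.
  - by rewrite le_max lexx.
  - move=> q /andP[aq _].
    suff : 0 < H j (edge_coord j (vtx i)) (on_edge u j (edge_coord j (vtx i))) q by lra.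
    apply: (lt_le_trans Hpos); apply: hamiltonian_norm_le => //.
    rewrite -(norm_a p) -(norm_a q) ler0_norm//.
    have := ler_norm (- (a_ i j * q)); rewrite normrN; move: aq; rewrite /a; lra.
have [m] := filter_ex slope.
rewrite gt_max => /andP[_]; apply/negP; rewrite -leNgt.
have : `|der j (un m) (vtx i)| <= M by apply: dM; rewrite iE; exists (edge_coord j (vtx i)).
apply: le_trans; rewrite -(norm_a (der _ _ _)) -normrN -mulrA mulN1r.
exact: ler_norm.
Qed.

(** If phi violates the supersolution inequality at the slope p, the Hamiltonian
is negative on [-|p|, |p|], so the lower slope -|p| of u is amplified to more
than |p|.  The conclusion does not depend on the sign of p, so it applies to
both edges of a test function. *)
Lemma outgoing_slope_gt0 i j (phi : 'rV[R]_n -> R) (S : set 'rV[R]_n) :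
  i \in trans N -> j \in inc i -> cedge j `<=` S ->
  derivable_in (param j) (on_edge phi j) (edge_coord j (vtx i)) ->
  local_min_on S (u \- phi) (vtx i) -> H_at H j u phi (vtx i) < 0 ->
  \forall m \near \oo, 0 < a_ i j * der j (un m) (vtx i).
Proof.
move=> iT ij jS dphi touch Hneg.
have [jy iE cc _] := inc_coord ij.
have norm_a x := norm_a_ x ij.
set p := der j phi (vtx i).
have : \forall m \near \oo, `|p| < 1 * a_ i j * der j (un m) (vtx i).
  apply: (vertex_derivative_gt_of_slope (phi := phi) (S := S) (a := - `|p|)) => //; first lra.
  - by apply: filterS touch => z /=; lra.
  - by rewrite -/p mul1r -(norm_a p) lerNl -normrN ler_norm.
  - by have := normr_ge0 p; lra.
  - move=> q; rewrite !mul1r -ler_norml norm_a => qp.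
    by apply: (le_lt_trans _ Hneg); exact: hamiltonian_norm_le.
apply: filterS => m; rewrite mul1r; exact: le_lt_trans.
Qed.

Context (H_vertex : forall i j k r p, i \in trans N -> j \in inc i -> k \in inc i ->
     H j (edge_coord j (vtx i)) r p = H k (edge_coord k (vtx i)) r p).

Lemma test_vertex_norm i j k phi : j \in inc i -> k \in inc i ->
  test_vertex i j k phi -> `|der j phi (vtx i)| = `|der k phi (vtx i)|.
Proof.
move=> ij ik [_ _ _ /eqP]; rewrite addr_eq0 => /eqP sum0.
by rewrite -(norm_a_ _ ij) sum0 normrN norm_a_.
Qed.

Lemma H_at_vertex_le i j k phi : i \in trans N -> j \in inc i -> k \in inc i ->
  `|der j phi (vtx i)| <= `|der k phi (vtx i)| ->
  H_at H j u phi (vtx i) <= H_at H k u phi (vtx i).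
Proof.
move=> iT ij ik pq; rewrite /H_at /on_edge /=.
have [_ <- _ _] := inc_coord ij; have [_ <- _ _] := inc_coord ik.
by rewrite (H_vertex _ _ iT ij ik); exact: hamiltonian_norm_le.
Qed.

End VanishingViscosity.

Lemma exists_other_edge (R : realType) (n : nat) (N : network_data R n)
    (netN : is_network N) (i : vidx N) (j : eidx N) :
  i \in trans N -> j \in inc i -> exists2 k, k \in inc i & k != j.
Proof.
rewrite inE => iT ij; apply: contrapT => none.
case/negP: iT; apply: (bdry_of_leaf netN).
apply/eqP/cards1P; exists j; apply/setP => k; rewrite finset.in_set1.
apply/idP/eqP => [ik|->//].
by apply/eqP/negPn/negP => kj; apply: none; exists k.
Qed.

Lemma continuous_lsc_on (R : realType) (T : topologicalType) (A : set T) (f : T -> R) :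
  {within A, continuous f} -> lsc_on A f.
Proof.
move=> fc x a; rewrite lte_fin => afx.
exists [set y | a < f y] => [|y]; last by rewrite /= lte_fin.
exact: (cvgr_gt _ (fc x)).
Qed.

(** * The vanishing viscosity limit *)

Unset Implicit Arguments.
Set Strict Implicit.
Set Printing Implicit Defensive.

Theorem theorem5p1 (R : realType) (n : nat) (N : network_data R n)
  (netN : is_network N)
  (beta : vidx N -> eidx N -> R) (g : vidx N -> R)
  (beta_gt0 : forall i j, i \in trans N -> j \in inc i -> 0 < beta i j)
  (H : hamiltonian N)
  (H_cont : forall j,
     {within param j `*` [set: R] `*` [set: R],
       continuous (fun z : R * R * R => H j z.1.1 z.1.2 z.2)})
  (H_mono_r : forall j x p, param j x -> {homo H j x ^~ p : r s / r <= s})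
  (H_mono_p : forall i j r, i \in trans N -> j \in inc i ->
     {in `]0, +oo[ &, {homo H j (edge_coord j (vtx i)) r : p q / p <= q}})
  (H_coercive : forall (K : R) j, 0 < K -> forall M : R, exists P : R,
     forall x r p, param j x -> `|r| <= K -> P <= `|p| -> M <= H j x r p)
  (H_vertex : forall i j k r p, i \in trans N -> j \in inc i -> k \in inc i ->
     H j (edge_coord j (vtx i)) r p = H k (edge_coord k (vtx i)) r p)
  (H_even : forall i j r p, i \in trans N -> j \in inc i ->
     H j (edge_coord j (vtx i)) r p = H j (edge_coord j (vtx i)) r (- p))
  (eps : nat -> R) (eps_gt0 : forall m, 0 < eps m)
  (eps_cvg0 : eps @ \oo --> (0 : R))
  (un : nat -> 'rV[R]_n -> R)
  (un_C2 : forall m, Ck_star beta 2 (un m))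
  (un_sol : forall m, viscous_solution (eps m) beta g H (un m))
  (un_bounded : exists M : R, forall m x, Gamma N x -> `|un m x| <= M)
  (dun_bounded : exists M : R, forall m (j : eidx N) x, cedge j x ->
     `|der j (un m) x| <= M)
  (u : 'rV[R]_n -> R) (u_C0 : C0 N u)
  (un_cvg : {uniform Gamma N, un @ \oo --> u}) :
  viscosity_solution H u.

Proof.
have [M dM] := dun_bounded.
split => //; split.
- apply: continuous_lsc_on => x; apply: continuousN; exact: u_C0.
- move=> j x phi jx tphi touch.
  suff : 0 <= -1 * H_at H j u phi x by lra.
  apply: (interior_touching netN H_cont eps_gt0 eps_cvg0 un_C2 un_sol u_C0 un_cvg) => //; first lra.
  by apply: filterS touch => z /=; lra.
- move=> i j k phi iT ij ik jk tphi touch.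
  have [phiC dj dk sum0] := tphi.
  have [desc|asc] := leP (a_ i j * der j phi (vtx i)) 0.
    apply: (subsolution_descending_edge netN H_cont eps_gt0 eps_cvg0 un_C2 un_sol u_C0 un_cvg
      H_mono_p H_even (fun m => dM m j) (S := cedge j `|` cedge k)) => //.
  apply: (@le_trans _ _ (H_at H k u phi (vtx i))).
    apply: (H_at_vertex_le netN H_cont u H_mono_p H_even H_vertex) => //.
    by rewrite (test_vertex_norm netN ij ik tphi).
  apply: (subsolution_descending_edge netN H_cont eps_gt0 eps_cvg0 un_C2 un_sol u_C0 un_cvg
      H_mono_p H_even (fun m => dM m k) (S := cedge j `|` cedge k)) => //.
  lra.
- exact: continuous_lsc_on.
- move=> j x phi jx tphi touch.
  suff : 0 <= 1 * H_at H j u phi x by lra.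
  apply: (interior_touching netN H_cont eps_gt0 eps_cvg0 un_C2 un_sol u_C0 un_cvg) => //; first lra.
  by apply: filterS touch => z /=; lra.
(* Otherwise every other edge k comes with a bad test function. *)
move=> i j iT ij; apply: contrapT => no_k.
have bad k : k \in inc i -> k != j -> exists phi, [/\ test_vertex i j k phi,
    local_min_on (cedge j `|` cedge k) (u \- phi) (vtx i) &
    H_at H j u phi (vtx i) < 0].
  move=> ik kj; apply: contrapT => no_phi; apply: no_k.
  exists k; first by rewrite ik.
  move=> phi tphi touch; rewrite leNgt; apply/negP => Hneg.
  by apply: no_phi; exists phi.
(* A bad test function controls both of its edges, so that of any k' serves j. *)
have outgoing k : k \in inc i ->
    \forall m \near \oo, 0 < a_ i k * der k (un m) (vtx i).
  move=> ik; have [->|kj] := eqVneq k j.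
    have [k' ik' kj'] := exists_other_edge netN iT ij.
    have [phi [[_ dj _ _] touch Hneg]] := bad k' ik' kj'.
    exact: (outgoing_slope_gt0 netN H_cont eps_gt0 eps_cvg0 un_C2 un_sol u_C0 un_cvg
      H_mono_p H_even (phi := phi) (S := cedge j `|` cedge k')).
  have [phi [tphi touch Hneg]] := bad k ik kj.
  have [_ _ dk _] := tphi.
  apply: (outgoing_slope_gt0 netN H_cont eps_gt0 eps_cvg0 un_C2 un_sol u_C0 un_cvg
      H_mono_p H_even (phi := phi) (S := cedge j `|` cedge k)) => //.
  apply: le_lt_trans Hneg.
  apply: (H_at_vertex_le netN H_cont u H_mono_p H_even H_vertex) => //.
    by rewrite (test_vertex_norm netN ij ik tphi).
have : \forall m \near \oo, forall k, k \in inc i -> 0 < a_ i k * der k (un m) (vtx i).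
  apply: filter_forall => k.
  have [ik|ik] := boolP (k \in inc i); last by near=> m.
  by apply: filterS (outgoing k ik).
move=> /filter_ex[m pos].
have [_ /(_ i iT) K0 _] := un_sol m.
suff : 0 < kirchhoff beta i (un m) by rewrite K0 ltxx.
rewrite /kirchhoff (bigD1 j)//=; apply: ltr_pwDl.
  by rewrite -mulrA mulr_gt0// ?beta_gt0 ?pos.
apply: sumr_ge0 => k /andP[ik _].
by rewrite -mulrA mulr_ge0// ltW// ?beta_gt0 ?pos.
Unshelve. all: by end_near.
Qed.
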